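(* Let $\mathfrak{A}$ be a countable $\bigstar$-residuated lattice. Then $(Min(\mathfrak{A});\tau_h)$ is a countably compact space.
   Context: A residuated lattice is an algebra $\mathfrak{A}=(A;\vee,\wedge,\odot,\rightarrow,0,1)$ such that $(A;\vee,\wedge,0,1)$ is a bounded lattice, $(A;\odot,1)$ is a commutative monoid, and $(\odot,\rightarrow)$ is an adjoint pair, i.e. $x\odot y\le z$ iff $x\le y\rightarrow z$. A filter of $\mathfrak{A}$ is a non-empty subset $F\subseteq A$ such that $x,y\in F$ implies $x\odot y\in F$, and $x\in F$, $y\in A$ imply $x\vee y\in F$. A filter is proper if it is not equal to $A$. A proper filter $P$ is prime if for all filters $F_1,F_2$, $F_1\cap F_2=P$ implies $F_1=P$ or $F_2=P$. $Min(\mathfrak{A})$ is the set of minimal prime filters (minimal elements, under inclusion, among all prime filters). For $X\subseteq A$ let $X^{\perp}=\{a\in A\mid x\vee a=1 \text{ for all } x\in X\}$ and $y^\perp=\{y\}^\perp$. ''Countable $\bigstar$-residuated lattice'' is a single term (it does not mean that $A$ is countable): $\mathfrak{A}$ is a countable $\bigstar$-residuated lattice if for every countable subset $X$ of $A$ there exists $y\in A$ such that $X^{\perp}=y^{\perp}$. The hull-kernel topology $\tau_h$ on $Min(\mathfrak{A})$ is the topology whose closed sets are the sets $h(X)=\{P\in Min(\mathfrak{A})\mid X\subseteq P\}$, $X\subseteq A$. A topological space is countably compact if every countable open cover has a finite subcover. *)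

(* Defs.v *)
From HB Require Import structures.
From mathcomp Require Import all_boot all_order all_classical.
From mathcomp Require Import topology.

Set Implicit Arguments.
Unset Strict Implicit.
Unset Printing Implicit Defensive.

Import Order.TTheory.

Local Open Scope order_scope.
Local Open Scope classical_set_scope.

(* The bounds 0 and 1 are [\bot] and [\top]; in particular the
   unit of the monoid is the top element.  The one-element algebra is allowed,
   and distributivity of the lattice is not assumed. *)
HB.mixin Record isResiduated (d : Order.disp_t) T & Order.TBLattice d T := {
  rmul : T -> T -> T;
  rimp : T -> T -> T;
  rmulA : associative rmul;
  rmulC : commutative rmul;
  rmul1x : left_id (\top : T) rmul;
  rmul_adjoint : forall x y z : T, (rmul x y <= z) = (x <= rimp y z);
}.

#[short(type="residuatedLatticeType")]
HB.structure Definition ResiduatedLattice (d : Order.disp_t) :=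
  { T of Order.TBLattice d T & isResiduated d T }.

Section Filters.
Context {d : Order.disp_t} {A : residuatedLatticeType d}.
Implicit Types (F P X : set A).

(* Filters of the algebra, unrelated to the filters of mathcomp's [Filter]. *)
Definition rl_filter F :=
  [/\ F !=set0,
      forall x y, F x -> F y -> F (rmul x y) &
      forall x y, F x -> F (Order.join x y)].

Definition proper_rl_filter F := rl_filter F /\ F <> setT.

Definition prime_rl_filter P :=
  proper_rl_filter P /\
  forall F1 F2, rl_filter F1 -> rl_filter F2 ->
    F1 `&` F2 = P -> F1 = P \/ F2 = P.

Definition minimal_prime P :=
  prime_rl_filter P /\
  forall Q, prime_rl_filter Q -> Q `<=` P -> Q = P.

Definition perp X : set A :=
  [set a | forall x, X x -> Order.join x a = \top].

End Filters.

(* "Countable" qualifies the subsets [X], not the carrier, and includes finite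
   (hence empty) subsets. *)
Definition countable_star (d : Order.disp_t) (A : residuatedLatticeType d) :=
  forall X : set A, countable X -> exists y : A, perp X = perp [set y].

(* A dedicated record rather than [set_type], which already carries the
   topology induced from the ambient type. *)
Record Min (d : Order.disp_t) (A : residuatedLatticeType d) := MkMin {
  Min_val : set A;
  Min_valP : minimal_prime Min_val
}.

HB.instance Definition _ d (A : residuatedLatticeType d) :=
  gen_eqMixin (Min A).
HB.instance Definition _ d (A : residuatedLatticeType d) :=
  gen_choiceMixin (Min A).

Definition hull (d : Order.disp_t) (A : residuatedLatticeType d) (X : set A)
  : set (Min A) := [set P | X `<=` Min_val P].

Definition hk_open (d : Order.disp_t) (A : residuatedLatticeType d)
  : set (set (Min A)) := [set U | exists X : set A, U = ~` hull X].

Section HullKernel.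
Context {d : Order.disp_t} {A : residuatedLatticeType d}.
Implicit Types (F P X : set A) (x y z : A).

Lemma rl_filter_le F x y : rl_filter F -> x <= y -> F x -> F y.
Proof. by case=> _ _ Fj /join_idPl <- Fx; rewrite joinC; apply: Fj. Qed.

Lemma rmul_le2 x y z t : x <= y -> z <= t -> rmul x z <= rmul y t.
Proof.
move=> xy zt; apply: (@le_trans _ _ (rmul y z)).
  by rewrite rmul_adjoint (le_trans xy)// -rmul_adjoint.
rewrite rmulC (rmulC y) rmul_adjoint (le_trans zt)// -rmul_adjoint.
exact: lexx.
Qed.

Lemma rmul_left x y : rmul x y <= x.
Proof.
apply: (le_trans (rmul_le2 (lexx x) (lex1 y))).
by rewrite rmulC rmul1x.
Qed.

Lemma rmul_join x y z :
  rmul (Order.join x y) (Order.join x z) <= Order.join x (rmul y z).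
Proof.
rewrite rmul_adjoint leUx -!rmul_adjoint; apply/andP; split.
  exact: le_trans (rmul_left _ _) (leUl _ _).
rewrite rmulC rmul_adjoint leUx -!rmul_adjoint; apply/andP; split.
  exact: le_trans (rmul_left _ _) (leUl _ _).
by rewrite rmulC leUr.
Qed.

Lemma prime_join P x y :
  prime_rl_filter P -> P (Order.join x y) -> P x \/ P y.
Proof.
move=> [[fP _] primeP] Pxy; have [[p Pp] PM PJ] := fP.
have joinM a b c : P (Order.join a b) -> P (Order.join a c) ->
    P (Order.join a (rmul b c)).
  by move=> ? ?; apply: (rl_filter_le fP (rmul_join _ _ _)); apply: PM.
pose F2 := [set b | P (Order.join x b)].
pose F1 := [set a | forall b, F2 b -> P (Order.join b a)].
have fF2 : rl_filter F2.
  split; first by exists y.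
    by move=> b c; apply: joinM.
  by move=> b c F2b; rewrite /F2/= joinA; apply: PJ.
have fF1 : rl_filter F1.
  split; first by exists x => b F2b; rewrite joinC.
    by move=> a c F1a F1c b F2b; apply: joinM; [apply: F1a|apply: F1c].
  by move=> a c F1a b F2b; rewrite joinA; apply: PJ; apply: F1a.
have F12 : F1 `&` F2 = P.
  apply/seteqP; split=> [a [F1a F2a]|a Pa].
    by rewrite -(joinxx a); apply: F1a.
  by split=> [b _|]; rewrite /F2/= joinC; apply: PJ.
case: (primeP _ _ fF1 fF2 F12) => <-; [left|right] => //.
by move=> b F2b; rewrite joinC.
Qed.

Let hk_openT : hk_open [set: Min A].
Proof.
exists setT; apply/seteqP; split=> // P _ /= TP.
have [[[_ +] _] _] := Min_valP P; apply.
by apply/seteqP; split.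
Qed.

Let hk_openI : setI_closed (@hk_open d A).
Proof.
move=> _ _ [X ->] [Y ->].
exists [set z | exists2 x, X x & exists2 y, Y y & z = Order.join x y].
rewrite -setCU; congr (~` _); apply/seteqP; split=> P /=; last first.
  move=> XYP; apply: contrapT => /not_orP[/existsNP[x /not_implyP[Xx nPx]]].
  move=> /existsNP[y /not_implyP[Yy nPy]].
  have [primeP _] := Min_valP P.
  have Pxy : Min_val P (Order.join x y) by apply: XYP; exists x => //; exists y.
  by case: (prime_join primeP Pxy).
have [[[[_ _ PJ] _] _] _] := Min_valP P.
move=> XYP z [x Xx [y Yy ->]].
case: XYP => [XP|YP]; first by apply: PJ; apply: XP.
by rewrite joinC; apply: PJ; apply: YP.
Qed.

Let hk_open_bigU (I : Type) (f : I -> set (Min A)) :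
  (forall i, hk_open (f i)) -> hk_open (\bigcup_i f i).
Proof.
move=> /choice[X fX]; exists (\bigcup_i X i).
rewrite (eq_bigcupr (fun i _ => fX i)) -setC_bigcap; congr (~` _).
apply/seteqP; split=> P /= hP; first by move=> x [i _ Xx]; apply: (hP i).
by move=> i _ x Xx; apply: hP; exists i.
Qed.

HB.instance Definition _ :=
  isOpenTopological.Build (Min A) hk_openT hk_openI hk_open_bigU.

Lemma closed_hull (C : set (Min A)) : closed C <-> exists X, C = hull X.
Proof.
rewrite -openC; split=> -[X CX]; exists X; last by rewrite CX.
exact: setC_inj.
Qed.

End HullKernel.

(* [cover_compact] restricted to covers with a countable index set. *)
Definition countably_compact (T : topologicalType) (K : set T) :=
  forall (I : choiceType) (D : set I) (f : I -> set T),
    countable D -> (forall i, D i -> open (f i)) -> K `<=` cover D f ->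
    finite_subset_cover D f K.

(* Main.v *)
(* Enumerate the cover, suppose that no finite part of it suffices, and choose
   for every [n] a minimal prime [p n] outside the first [n] open sets.  Let [S]
   consist of the [y] such that [perp [set y]] is contained in the perp of some
   tail [c m, c m.+1, ...] with [c n] outside [p n].  Then [S] is join-closed
   and misses the top, so some minimal prime [P] is disjoint from [S].  If [x]
   is eventually in [p n] but not in [P], then minimality of [p n] gives [c n]
   outside [p n] with [x \/ c n = 1]; the star condition replaces the tail of
   [c] by one [y] in [S], so [x \/ y = 1] and [y] lies in [P], which is absurd.
   Hence [P] is outside every member of the cover. *)
Require Import Defs.
From mathcomp Require Import all_boot all_order all_classical.
From mathcomp Require Import topology.

Set Implicit Arguments.
Unset Strict Implicit.
Unset Printing Implicit Defensive.

Import Order.TTheory.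

Local Open Scope classical_set_scope.

(** [Zorn_bigcup] also asks for the union of the empty chain, which is not a filter. Applied to the
    sets [X] with [P (X0]|[X)], it meets only [X0] there. *)
Lemma Zorn_above (T : Type) (P : set (set T)) (X0 : set T) :
  P X0 ->
  (forall F : set (set T), F !=set0 -> F `<=` P -> total_on F subset ->
    P (\bigcup_(X in F) X)) ->
  exists A, [/\ X0 `<=` A, P A & forall B, A `<=` B -> P B -> B = A].
Proof.
move=> PX0 Pcup.
have [F FP totF|A [PA maxA]] := @Zorn_bigcup T [set X | P (X0 `|` X)].
  have [->|/set0P[X FX]] := eqVneq F set0.
    by rewrite /= bigcup_set0 setU0.
  rewrite /=; have -> : X0 `|` \bigcup_(X in F) X =
      \bigcup_(Y in [set X0 `|` X | X in F]) Y.
    apply/seteqP; split=> x.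
      move=> [X0x|[Y FY Yx]]; first by exists (X0 `|` X); [exists X|left].
      by exists (X0 `|` Y); [exists Y|right].
    by move=> [_ [Y FY <-] [X0x|Yx]]; [left|right; exists Y].
  apply: Pcup; first by exists (X0 `|` X), X.
    by move=> _ [Y FY <-]; exact: FP.
  move=> _ _ [Y FY <-] [Z FZ <-].
  by case: (totF _ _ FY FZ) => YZ; [left|right]; exact: setUS.
exists (X0 `|` A); split=> [|//|]; first exact: subsetUl.
move=> B AB PB; apply: contrapT => BA; apply: (maxA B); last first.
  by rewrite /= setUidr// => x X0x; apply: AB; left.
split=> [x Ax|BsubA]; first by apply: AB; right.
by apply: BA; apply/seteqP; split=> // x Bx; right; exact: BsubA.
Qed.

Section MinimalPrimes.
Context {d : Order.disp_t} {A : residuatedLatticeType d}.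
Implicit Types (F P S : set A) (x y z : A).

Definition join_closed S := forall x y, S x -> S y -> S (Order.join x y).

Lemma rl_filter_top F : rl_filter F -> F \top%O.
Proof.
by move=> fF; have [[x Fx] _ _] := fF; apply: (rl_filter_le fF _ Fx); exact: lex1.
Qed.

Lemma prime_rl_filterN0 P : prime_rl_filter P -> (~` P) !=set0.
Proof.
move=> [[_ PT] _]; apply: contrapT => nP; apply: PT.
apply/seteqP; split=> // x _; by apply: contrapT => Px; apply: nP; exists x.
Qed.

Lemma join_closed_primeC P : prime_rl_filter P -> join_closed (~` P).
Proof. by move=> primeP x y nPx nPy /(prime_join primeP)[]. Qed.

(** A filter [P] maximal among those disjoint from [S] is prime: if [P] is the intersection of two
    strictly larger filters, these meet [S] in some [t] and [u], and the join of [t] and [u] lies in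
    both [P] and [S]. *)
Lemma prime_rl_filter_disjoint S : S !=set0 -> join_closed S -> ~ S \top%O ->
  exists2 P, prime_rl_filter P & P `<=` ~` S.
Proof.
move=> [s Ss] SJ S1.
have [||P [_ [fP PS] maxP]] :=
    @Zorn_above A [set F | rl_filter F /\ F `<=` ~` S] [set \top%O].
- split=> [|_ ->//]; split; first by exists \top%O.
    by move=> _ _ -> ->; rewrite /= rmul1x.
  by move=> _ y ->; rewrite /= join1x.
- move=> G [F GF] GP totG; split; last first.
    by move=> x [F' /GP[_ F'S] F'x]; exact: F'S.
  split.
  + by have [[[x Fx] _ _] _] := GP _ GF; exists x, F.
  + move=> x y [F1 GF1 F1x] [F2 GF2 F2y].
    have [[_ F1M _] _] := GP _ GF1; have [[_ F2M _] _] := GP _ GF2.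
    case: (totG _ _ GF1 GF2) => F12.
      by exists F2 => //; apply: F2M => //; exact: F12.
    by exists F1 => //; apply: F1M => //; exact: F12.
  + move=> x y [F' GF' F'x]; exists F' => //.
    by have [[_ _ F'J] _] := GP _ GF'; exact: F'J.
have larger F : rl_filter F -> P `<=` F -> F <> P -> exists2 t, F t & S t.
  move=> fF PF FP; apply: contrapT => nFS; apply: FP; apply: maxP => //.
  by split=> // x Fx Sx; apply: nFS; exists x.
exists P => //; split.
  by split=> // PT; apply: (PS s) => //; rewrite PT.
move=> F1 F2 fF1 fF2 F12; apply: contrapT => /not_orP[F1P F2P].
have [|||t F1t St] := larger F1 => //; first by rewrite -F12; exact: subIsetl.
have [|||u F2u Su] := larger F2 => //; first by rewrite -F12; exact: subIsetr.
apply: (PS (Order.join t u)); last exact: SJ.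
rewrite -F12; split; first by have [_ _] := fF1; apply.
by rewrite joinC; have [_ _] := fF2; apply.
Qed.

(* Minimal primes are the complements of maximal join-closed sets avoiding the
   top. *)
Lemma minimal_prime_disjoint S : S !=set0 -> join_closed S -> ~ S \top%O ->
  exists2 P, minimal_prime P & P `<=` ~` S.
Proof.
move=> [s Ss] SJ S1.
have [||M [SM [MJ M1] maxM]] :=
  @Zorn_above A [set S | join_closed S /\ ~ S \top%O] S => //.
  move=> G [F GF] GP totG; split; last by move=> [F' /GP[]].
  move=> x y [F1 GF1 F1x] [F2 GF2 F2y].
  have [F1J _] := GP _ GF1; have [F2J _] := GP _ GF2.
  case: (totG _ _ GF1 GF2) => F12.
    by exists F2 => //; apply: F2J => //; exact: F12.
  by exists F1 => //; apply: F1J => //; exact: F12.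
(* Used twice: for the prime found next, and for any prime inside it, which gives minimality. *)
have primeM Q : prime_rl_filter Q -> Q `<=` ~` M -> Q = ~` M.
  move=> primeQ QM; rewrite -(maxM (~` Q)) ?setCK//.
    by move=> x Mx Qx; exact: (QM x).
  split; first exact: join_closed_primeC.
  by apply; apply: rl_filter_top; have [[]] := primeQ.
have [|P primeP PM] := @prime_rl_filter_disjoint M _ MJ M1.
  by exists s; exact: SM.
have PE := primeM P primeP PM.
exists P; last by rewrite PE; exact: subsetC.
by split=> // Q primeQ QP; rewrite PE; apply: primeM => // x /QP/PM.
Qed.

(** Otherwise the complement of [P], enlarged by its joins with [x], is join-closed and avoids the
    top. A prime disjoint from it lies in [P], hence equals [P], yet [P] contains these joins. *)
Lemma minimal_prime_complement P x : minimal_prime P -> P x ->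
  exists2 y, ~ P y & Order.join x y = \top%O.
Proof.
move=> [primeP minP] Px; have [[fP _] _] := primeP; have [_ _ PJ] := fP.
have [b nPb] := prime_rl_filterN0 primeP; have CJ := join_closed_primeC primeP.
apply: contrapT => nxy.
pose S := ~` P `|` [set Order.join x y | y in ~` P].
have [|||Q primeQ QS] := @prime_rl_filter_disjoint S.
- by exists b; left.
- move=> y' z' [nPy|[y nPy <-]] [nPz|[z nPz <-]].
  + by left; exact: CJ.
  + by right; eexists; [exact: CJ nPy nPz|rewrite joinCA].
  + by right; eexists; [exact: CJ nPy nPz|rewrite joinA].
  + by right; eexists; [exact: CJ nPy nPz|rewrite joinACA joinxx].
- case=> [|[y nPy xy]]; first by apply; exact: rl_filter_top.
  by apply: nxy; exists y.
have QP : Q = P.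
  by apply: minP => // z Qz; apply: contrapT => nPz; apply: (QS z) => //; left.
apply: (QS (Order.join x b)); first by rewrite QP; exact: PJ.
by right; exists b.
Qed.

(** Since the closed sets are the hulls, this says that [P] lies in every closed set containing a
    tail of [p]: it is a cluster point of [p]. *)
Lemma minimal_prime_cluster (p : nat -> Min A) : countable_star A ->
  exists P : Min A, forall m x,
    (forall n, (m <= n)%N -> Min_val (p n) x) -> Min_val P x.
Proof.
move=> starA.
pose S := [set y | exists m (c : nat -> A),
  (forall n, (m <= n)%N -> ~ Min_val (p n) (c n)) /\
  perp [set y] `<=` perp [set c n | n in [set n | (m <= n)%N]]].
have primep n : prime_rl_filter (Min_val (p n)) by have [] := Min_valP (p n).
have [|||P minP PS] := @minimal_prime_disjoint S.
- have /choice[c nc] n : exists z, ~ Min_val (p n) z.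
    by have [z] := prime_rl_filterN0 (primep n); exists z.
  (* The perp of [\bot] is the singleton of the top, so any choice of [c] works. *)
  exists \bot%O, 0, c; split=> // a /(_ _ erefl); rewrite join0x => -> x _.
  by rewrite joinx1.
- move=> y y' [m [c [nc yc]]] [m' [c' [nc' yc']]].
  exists (maxn m m'), (fun n => Order.join (c n) (c' n)); split.
    move=> n; rewrite geq_max => /andP[mn m'n].
    by apply: join_closed_primeC => //; [exact: nc|exact: nc'].
  move=> a /(_ _ erefl) yy'a _ [n /= + <-]; rewrite geq_max => /andP[mn m'n].
  (* The two inclusions are used in turn: [y'] is replaced by [c' n], then [y] by [c n]. *)
  have yc'a : perp [set y] (Order.join (c' n) a).
    move=> _ ->; rewrite joinCA; apply: (yc' (Order.join y a)); last by exists n.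
    by move=> _ ->; rewrite joinA (joinC y') yy'a.
  by rewrite -joinA; apply: yc yc'a _ _; exists n.
(* The perp of the top contains [\bot], which would force [c m] to be the top, an element of
   [p m]. *)
- move=> [m [c [nc /(_ \bot%O)]]] yc.
  apply: (nc m (leqnn m)); rewrite -[c m]joinx0 yc; last by exists m => /=.
    by apply: rl_filter_top; have [[]] := primep m.
  by move=> _ ->; rewrite join1x.
exists (MkMin minP) => m x px /=; apply: contrapT => nPx.
have /choice[c cP] n : exists z, (m <= n)%N ->
    ~ Min_val (p n) z /\ Order.join x z = \top%O.
  (* Below [m] the value [x] is a dummy. *)
  have [mn|_] := boolP (m <= n)%N; last by exists x.
  have [z nz xz] := minimal_prime_complement (Min_valP (p n)) (px n mn).
  by exists z.
have [|y cy] := starA [set c n | n in [set n | (m <= n)%N]].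
  exact: (sub_countable (card_image_le _ _)).
have xy : perp [set y] x.
  by rewrite -cy => _ [n /= mn <-]; rewrite joinC; case: (cP n mn).
have [primeP _] := minP.
have /(prime_join primeP)[//|Py] : P (Order.join x y).
  by rewrite joinC xy//; apply: rl_filter_top; case: primeP => [[]].
apply: (PS y) => //; exists m, c; rewrite cy; split=> // n mn.
by case: (cP n mn).
Qed.

End MinimalPrimes.

Local Close Scope classical_set_scope.

Theorem theorem4p12 (d : Order.disp_t) (A : residuatedLatticeType d)
    (starA : countable_star A) :
  countably_compact [set: Min A]%classic.
Proof.
move=> I D f /countable_injP[g ginj] fopen fcover; apply: contrapT => nfin.
have /choice[p pP] n : exists P : Min A,
    forall i, D i -> (g i < n)%N -> ~ f i P.
  apply: contrapT => nP; apply: nfin.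
  (* [g] injects these indices into the numbers below [n]; if no [P] avoided their sets, they would
     index a finite subcover. *)
  have /finite_fsetP[D' D'E] : finite_set [set i | D i /\ (g i < n)%N]%classic.
    apply/finite_set_leP; exists n; apply/pcard_leP/injfunPex; exists g.
      by move=> i [].
    by move=> i j /[!inE] -[Di _] [Dj _]; apply: ginj; rewrite inE.
  exists D' => [i D'i|P _].
    suff [Di _] : [set i | D i /\ (g i < n)%N]%classic i by rewrite inE.
    by rewrite D'E.
  apply: contrapT => nfP; apply: nP; exists P => i Di gi fiP.
  by apply: nfP; exists i => //; rewrite -D'E.
have [P PP] := minimal_prime_cluster p starA.
have [i Di] := fcover P Logic.I.
have [X fiE] := fopen i Di.
(* From index [(g i).+1] on, [p n] avoids [f i], that is, contains all of [X]; hence so does [P]. *)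
rewrite fiE; apply => x Xx; apply: (PP (g i).+1) => n gin.
apply: contrapT => npx; apply: (pP n i Di gin); rewrite fiE => /(_ x Xx).
exact: npx.
Qed.
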